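(* Let $K$ be a metric space such that $K^{(n)}\ne\emptyset$ for all $n=1,2,\dots$. Then for every positive integer $n$, there exist sets $A,B\subset K$ with $i(A)=n$, $i(B)=n$, $\|\chi_A\|_D=n$ and $\|\chi_B\|_D=n+1$.
   Context: $K^{(0)}=K$, and $K^{(n+1)}$ is the set of cluster (non-isolated) points of the metric subspace $K^{(n)}$. For $L\subset K$, $\partial_LA$ denotes the boundary of $A\cap L$ relative to the metric subspace $L$. Put $\partial^0A=K$ and $\partial^{n+1}A=\partial_LA$ where $L=\partial^nA$. The index $i(A)$ is the largest $n$ with $\partial^nA\ne\emptyset$ if there is such an $n$, and $\infty$ otherwise. $\chi_A$ is the characteristic function of $A$. $D(K)$ is the set of all $f:K\to\mathbb{C}$ of the form $f=(\varphi_1-\varphi_2)+i(\varphi_3-\varphi_4)$ with $\varphi_1,\dots,\varphi_4$ bounded real-valued lower semi-continuous functions on $K$. Equivalently, $f\in D(K)$ iff there is a sequence $(\varphi_j)$ of continuous complex-valued functions on $K$ with $\sup_{k\in K}\sum_j|\varphi_j(k)|<\infty$ and $f=\sum_j\varphi_j$ pointwise; $\|f\|_D$ is the infimum of $\sup_{k\in K}\sum_j|\varphi_j(k)|$ over all such sequences. *)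

(* Defs.v *)
From HB Require Import structures.
From mathcomp Require Import all_boot all_order all_algebra.
From mathcomp Require Import complex.
From mathcomp Require Import all_classical all_reals all_analysis.

Set Implicit Arguments.
Unset Strict Implicit.
Unset Printing Implicit Defensive.

Import Order.TTheory GRing.Theory Num.Theory.
Import numFieldNormedType.Exports.

Local Open Scope classical_set_scope.
Local Open Scope ring_scope.

Section derived_sets.
Context {T : topologicalType}.

(* [isolated L] is the set of points of [L] that are isolated in the subspace
   [L]. *)
Fixpoint derived_set (n : nat) : set T :=
  if n is m.+1 then derived_set m `\` isolated (derived_set m) else setT.

End derived_sets.

Definition boundary {T : topologicalType} (A : set T) : set T :=
  closure A `\` interior A.

Section boundary_index.
Context {T : topologicalType}.
Implicit Types A L : set T.

(* [subspace L] is a copy of [T] whose topology induces the subspace topology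
   on [L] and makes the points outside [L] isolated: those points belong to
   the boundary of no set, so this is the boundary in the subspace [L]. *)
Definition rel_boundary L A : set T :=
  @boundary (subspace L) (A `&` L).

Fixpoint iter_boundary (n : nat) A : set T :=
  if n is m.+1 then rel_boundary (iter_boundary m A) A else setT.

Definition boundary_index A : \bar nat :=
  xget +oo%E [set n%:E%E | n in [set n : nat | iter_boundary n A !=set0 /\
    forall m, iter_boundary m A !=set0 -> (m <= n)%N]].

End boundary_index.

Section D_space.
Context {R : realType} {T : topologicalType}.

Definition bounded_lsc (phi : T -> R) :=
  bounded_fun phi /\ lower_semicontinuous (EFin \o phi).

Definition D_space : set (T -> R[i]) :=
  [set f | exists phi1 phi2 phi3 phi4 : T -> R,
    [/\ bounded_lsc phi1, bounded_lsc phi2, bounded_lsc phi3, bounded_lsc phi4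
      & f = fun k => Complex (phi1 k - phi2 k) (phi3 k - phi4 k)]].

Definition sup_abs_series (phi : nat -> T -> R[i]) : \bar R :=
  ereal_sup (range (fun k => \sum_(0 <= j <oo) (Normc.normc (phi j k))%:E))%E.

(* [R[i]^o] is [R[i]] with the topology given by its modulus. *)
Definition D_representation (f : T -> R[i]) (phi : nat -> T -> R[i]) :=
  [/\ forall j, continuous (phi j : T -> R[i]^o),
      (sup_abs_series phi < +oo)%E
    & forall k, series (phi ^~ k : nat -> R[i]^o) @ \oo --> (f k : R[i]^o)].

(* Equal to +oo when [f] has no representation, i.e. outside [D_space]. *)
Definition D_norm (f : T -> R[i]) : \bar R :=
  ereal_inf [set sup_abs_series phi | phi in D_representation f].

End D_space.

(* Main.v *)
Require Import Defs.
From mathcomp Require Import all_boot all_order all_algebra.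
From mathcomp Require Import complex.
From mathcomp Require Import all_classical all_reals all_analysis.
From mathcomp Require Import lra.

Import Order.TTheory GRing.Theory Num.Theory.
Import numFieldNormedType.Exports.

Local Open Scope classical_set_scope.
Local Open Scope ring_scope.

(* Since K^(n) is nonempty there is a chain of closed sets
   K = F_0 > F_1 > ... > F_n <> 0 = F_(n+1), each nowhere dense in the previous
   one: starting from a point of K^(n), enlarge F_(j+1) to F_j by a set of
   isolated points of F_j, taken in K^(j) and accumulating exactly at F_(j+1).
   Let A consist of the strata F_m \ F_(m+1) with m of a given parity.  Then the
   m-th iterated boundary of A is F_m, so i(A) = n.  Going down the strata from
   F_n, the partial sums of any series representing the characteristic function
   must oscillate by 1 at each step, so its norm is at least n, plus 1 if
   F_n is contained in A; summation by parts writes the characteristic function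
   as a combination with coefficients +1 and -1 of that many characteristic
   functions of open sets, each of which has norm at most 1. *)

(** * Boundaries relative to a subset *)

Lemma rel_boundaryE {T : topologicalType} (L A : set T) :
  rel_boundary L A = L `&` (closure (A `&` L) `&` closure (L `\` A)).
Proof.
rewrite /rel_boundary /boundary; apply/seteqP; split=> x /=.
- case=> clx /= intx.
  have Lx : L x.
    apply: contrapT => nLx; have : nbhs (x : subspace L) [set x].
      by case: (nbhs_subspaceP L x) => // _ y.
    by move=> /clx [y [[_ Ly] yx]]; apply: nLx; rewrite -yx.
  split=> //; split.
    move=> B Bx; have : nbhs (x : subspace L) B.
      case: (nbhs_subspaceP L x) => // _.
      by apply: filterS Bx => y By _.
    by move=> /clx.
  move=> B Bx; apply: contrapT => nex; apply: intx; rewrite /interior/=.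
  case: (nbhs_subspaceP L x) => // _.
  apply: filterS Bx => y By Ly; split=> //; apply: contrapT => nAy.
  by apply: nex; exists y.
- case=> Lx [clA clN]; split.
    move=> B; case: (nbhs_subspaceP L x) => // _.
    by move=> /clA [y [[Ay Ly] By]]; exists y; split => //; exact: By.
  rewrite /interior/=; case: (nbhs_subspaceP L x) => // _.
  by move=> /clN [y [[Ly nAy] By]]; case: (By Ly).
Qed.

(** * Nowhere dense chains and the boundary index of unions of strata *)

Section chains.
Context {T : topologicalType}.
Implicit Types F : nat -> set T.

(** The last clause says that [F m.+1] has empty interior relative to [F m]. Finite chains are
    encoded by letting the sequence end in empty sets. *)
Definition nowhere_dense_chain F :=
  [/\ forall m, closed (F m), forall m, F m.+1 `<=` F m
    & forall m, F m.+1 `<=` closure (F m `\` F m.+1)].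

Definition stratum F m := F m `\` F m.+1.

Definition parity_union F (b : bool) :=
  [set x | exists2 m, odd m = b & stratum F m x].

Lemma chain_le F m p : nowhere_dense_chain F -> (m <= p)%N -> F p `<=` F m.
Proof.
move=> [_ sF _] /subnK <-; elim: (p - m)%N => [//|k IH] x.
by rewrite addSn => /sF /IH.
Qed.

Lemma stratum_inj F m p x : nowhere_dense_chain F ->
  stratum F m x -> stratum F p x -> m = p.
Proof.
move=> cF [Fm Fm1] [Fp Fp1]; case: (ltngtP m p) => // [mp|pm].
- by case: Fm1; apply: chain_le mp _ Fp.
- by case: Fp1; apply: chain_le pm _ Fm.
Qed.

Lemma parity_union_stratum F b m x : nowhere_dense_chain F ->
  stratum F m x -> parity_union F b x <-> odd m = b.
Proof.
move=> cF Fm; split=> [[p pb Fp]|mb]; last by exists m.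
by rewrite (stratum_inj _ _ _ _ cF Fm Fp).
Qed.

Lemma stratum_closure F m : nowhere_dense_chain F ->
  stratum F m.+1 `<=` closure (stratum F m).
Proof. by move=> [_ _ dF] x [/dF]. Qed.

Lemma chain_sub_closure F m : nowhere_dense_chain F ->
  F m `<=` closure (stratum F m).
Proof.
move=> [_ _ dF] x Fmx; have [Fx|nFx] := pselect (F m.+1 x); first exact: dF.
by apply: subset_closure.
Qed.

Lemma chain_stratum F n x : nowhere_dense_chain F -> F 0%N x -> ~ F n.+1 x ->
  exists2 m, (m <= n)%N & stratum F m x.
Proof.
move=> cF F0; elim: n => [|n IH] nF; first by exists 0%N.
have [Fx|/IH[m mn Fm]] := pselect (F n.+1 x); first by exists n.+1.
by exists m => //; exact: leqW.
Qed.

(** [stratum F m] is relatively open in [F m] and lies wholly inside or wholly outside the union, so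
    it contains no boundary point. A point of [F m.+1] is a limit of [stratum F m] and of
    [stratum F m.+1], whose indices have opposite parities. *)
Lemma iter_boundary_parity_union F b m : nowhere_dense_chain F ->
  F 0%N = setT -> iter_boundary m (parity_union F b) = F m.
Proof.
move=> cF F0; elim: m => [//|m IH] /=; rewrite IH rel_boundaryE.
have [cl sF dF] := cF.
apply/seteqP; split=> x.
- move=> [Fmx [clA clN]]; apply: contrapT => nFx.
  have nx : nbhs x (~` F m.+1).
    by apply: open_nbhs_nbhs; split=> //; exact: closed_openC.
  have [y [[ay Fy] nFy]] := clA _ nx.
  have [z [[Fz az] nFz]] := clN _ nx.
  apply: az; apply/(parity_union_stratum F b m z cF); first by split.
  by apply/(parity_union_stratum F b m y cF) => //; split.
- move=> Fx; split; first exact: sF.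
  have sub p : (m <= p)%N -> odd p = b ->
      stratum F p `<=` parity_union F b `&` F m.
    move=> mp pb y Fy; split; first by exists p.
    by case: Fy => Fy _; apply: chain_le mp _ Fy.
  have subN p : (m <= p)%N -> odd p <> b ->
      stratum F p `<=` F m `\` parity_union F b.
    move=> mp pb y Fy; split; first by case: Fy => Fy _; apply: chain_le mp _ Fy.
    by move/(parity_union_stratum F b p y cF Fy).
  have clm := dF _ _ Fx; have clm1 := chain_sub_closure _ _ cF _ Fx.
  have [mb|mb] := eqVneq (odd m) b; split.
  + exact: closureS (sub _ (leqnn m) mb) _ clm.
  + by apply: closureS (subN _ (leqnSn m) _) _ clm1 => /=; rewrite mb; case: (b).
  + apply: closureS (sub _ (leqnSn m) _) _ clm1.
    by move: mb => /=; case: (odd m); case: (b).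
  + by apply: closureS (subN _ (leqnn m) _) _ clm; exact/eqP.
Qed.

Lemma boundary_index_parity_union F b n : nowhere_dense_chain F ->
  F 0%N = setT -> F n !=set0 -> F n.+1 = set0 ->
  boundary_index (parity_union F b) = n%:E%E.
Proof.
move=> cF F0 Fn Fn1; rewrite /boundary_index; case: xgetP => [y -> /=|].
  move=> [k [Fk kmax]] <-; congr EFin; apply/eqP; rewrite eqn_leq.
  rewrite kmax ?iter_boundary_parity_union// andbT leqNgt; apply/negP => nk.
  move: Fk; rewrite iter_boundary_parity_union// => -[x /(chain_le _ _ _ cF nk)].
  by rewrite Fn1.
(* The default value [+oo] is excluded because [n] is such a maximum. *)
move=> /(_ n%:E%E); case; exists n => //; split.
  by rewrite iter_boundary_parity_union.
move=> m; rewrite iter_boundary_parity_union// leqNgt => -[x Fm].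
by apply/negP => nm; have := chain_le _ _ _ cF nm _ Fm; rewrite Fn1.
Qed.

Definition chain_cons (A : set T) F : nat -> set T :=
  fun m => if m is m'.+1 then F m' else A.

Lemma nowhere_dense_chain_cons A F : nowhere_dense_chain F -> closed A ->
  F 0%N `<=` A -> F 0%N `<=` closure (A `\` F 0%N) ->
  nowhere_dense_chain (chain_cons A F).
Proof. by move=> [cF sF dF] cA sA dA; split; case. Qed.

(** An isolated point [z] of [A] is not isolated in [derived_set m], so a neighbourhood meeting [A]
    only in [z] still contains further points of [derived_set m], all outside [A]. Density of the
    isolated points carries this to all of [A]. *)
Lemma derived_set_closure m (A : set T) : A `<=` derived_set m.+1 ->
  A `<=` closure (isolated A) -> A `<=` closure (derived_set m `\` A).
Proof.
move=> Am iA x Ax V Vx.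
have [z [[/set_mem Az [W Wz WA]] Vz]] := iA x Ax _ (nbhs_interior Vx).
have [dz niz] := Am _ Az.
have WVz : nbhs z (W `&` V) by exact: filterI.
apply: contrapT => nex; apply: niz; split; first exact/mem_set.
exists (W `&` V) => //; apply/seteqP; split=> [y [[Wy Vy] dy]|_ ->]; last first.
  by split=> //; apply: nbhs_singleton.
have [Ay|nAy] := pselect (A y); first by rewrite -WA.
by exfalso; apply: nex; exists y.
Qed.

End chains.

(** * Distance to a set, and construction of chains in a metric space *)

Section metric_chains.
Context {R : realType} {K : metricType R}.
Implicit Types (F E D : set K) (x y z : K).

(** The infimum of the empty set is 0, which is why [set_dist_gt0] asks for [F] nonempty. *)
Definition set_dist F x : R := inf [set mdist x y | y in F].

Let has_lbound_dist F x : has_lbound [set mdist x y | y in F].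
Proof. by exists 0 => _ [y _ <-]; exact: mdist_ge0. Qed.

Lemma set_dist_le F x y : F y -> set_dist F x <= mdist x y.
Proof. by move=> Fy; apply: ge_inf => //; exists y. Qed.

Lemma set_dist_triangle F x y : set_dist F x <= mdist x y + set_dist F y.
Proof.
have [->|/set0P[z0 Fz0]] := eqVneq F set0.
  by rewrite /set_dist !image_set0 !inf0 addr0 mdist_ge0.
rewrite -lerBlDl; apply: lb_le_inf; first by exists (mdist y z0), z0.
move=> _ [z Fz <-]; rewrite lerBlDl.
exact: le_trans (set_dist_le _ _ _ Fz) (metric_triangle _ _ _).
Qed.

Lemma set_dist_ge0 F x : 0 <= set_dist F x.
Proof.
have [->|/set0P[z0 Fz0]] := eqVneq F set0.
  by rewrite /set_dist image_set0 inf0.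
apply: lb_le_inf; first by exists (mdist x z0), z0.
by move=> _ [z _ <-]; exact: mdist_ge0.
Qed.

Lemma nbhs_mdist x (V : set K) :
  nbhs x V <-> exists2 r, 0 < r & forall y, mdist x y < r -> V y.
Proof.
rewrite -nbhs_ballE; split=> -[r r0 rV]; exists r => //.
  by move=> y xy; apply: rV; rewrite ballEmdist.
by rewrite ballEmdist.
Qed.

Lemma set_dist_gt0 F x : closed F -> F !=set0 -> ~ F x -> 0 < set_dist F x.
Proof.
move=> clF [z0 Fz0] nFx.
have : nbhs x (~` F).
  by apply: open_nbhs_nbhs; split=> //; exact: closed_openC.
move=> /nbhs_mdist[r r0 rF]; apply: lt_le_trans r0 _.
apply: lb_le_inf; first by exists (mdist x z0), z0.
by move=> _ [y Fy <-]; rewrite leNgt; apply/negP => /rF.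
Qed.

Lemma set_dist_eq0 F x : F x -> set_dist F x = 0.
Proof.
move=> Fx; apply/eqP; rewrite eq_le set_dist_ge0 andbT.
by apply: le_trans (set_dist_le _ _ _ Fx) _; rewrite mdistxx.
Qed.

Lemma set_dist_continuous F : continuous (set_dist F).
Proof.
move=> x; apply/cvgrPdist_lt => e e0; apply/nbhs_mdist; exists e => // y xy.
apply: le_lt_trans xy; rewrite ler_norml.
have := set_dist_triangle F x y; have := set_dist_triangle F y x.
by rewrite (metric_sym y x) => *; apply/andP; split; lra.
Qed.

(** Separation at the scale of the distance to [F] lets [E] accumulate only on [F], which gives
    closedness and isolation; maximality makes it accumulate at every point of [F]. *)
Lemma discrete_extension F D : closed F -> F !=set0 ->
    F `<=` closure (D `\` F) ->
  exists E, [/\ E `<=` D `\` F, closed (F `|` E), F `<=` closure E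
    & E `<=` isolated (F `|` E)].
Proof.
move=> clF F0 FD.
(* A maximal subset of [D `\` F] separated at the scale of the distance to [F]. *)
pose P E := E `<=` D `\` F /\ forall x y, E x -> E y -> x != y ->
  set_dist F x <= 2 * mdist x y.
have [|E [[ED Esep] Emax]] := @Zorn_bigcup _ P.
  move=> C CP totC; split=> [x [X CX Xx]|x y [X CX Xx] [Y CY Yy]].
    by have [XD _] := CP _ CX; exact: XD.
  have [XY|YX] := totC _ _ CX CY.
    by have [_ sep] := CP _ CY; apply: sep => //; exact: XY.
  by have [_ sep] := CP _ CX; apply: sep => //; exact: YX.
(* With [d] the distance from [x] to [F], two points of [E] in the ball of radius [d / 8] are less
   than [d / 4] apart, but their distance to [F] exceeds [7 * d / 8], so distinct ones would be at
   least [7 * d / 16] apart. *)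
have near1 x : ~ F x -> exists2 V, nbhs x V & (V `&` F = set0) /\
    forall y z, V y -> V z -> E y -> E z -> y = z.
  move=> nFx; have dx := set_dist_gt0 _ _ clF F0 nFx.
  exists [set y | mdist x y < set_dist F x / 8].
    by apply/nbhs_mdist; exists (set_dist F x / 8) => //; rewrite divr_gt0.
  split=> [|y z xy xz Ey Ez].
    rewrite -subset0 => y [/= xy Fy].
    have := le_lt_trans (set_dist_le _ x _ Fy) xy; lra.
  apply: contrapT => /eqP yz; have := Esep _ _ Ey Ez yz.
  have := metric_triangle y x z; have := set_dist_triangle F x y.
  move: xy xz => /=; rewrite (metric_sym y x); lra.
exists E; split=> //.
- move=> x clx; apply: contrapT => /not_orP[nFx nEx].
  have [V Vx [VF VE]] := near1 _ nFx.
  have [y [FEy Vy]] := clx _ Vx.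
  have Ey : E y by case: FEy => // Fy; exfalso; rewrite -[False]/(set0 y) -VF.
  have xy : 0 < mdist x y by rewrite mdist_gt0; apply: contra_notN nEx => /eqP->.
  have : nbhs x (V `&` [set z | mdist x z < mdist x y]).
    by apply: filterI => //; apply/nbhs_mdist; exists (mdist x y).
  move=> /clx[z [FEz [Vz /= zy]]].
  have Ez : E z by case: FEz => // Fz; exfalso; rewrite -[False]/(set0 z) -VF.
  by move: zy; rewrite (VE z y) // ltxx.
(* If the [r]-ball at [x] missed [E], a point [z] of [D] outside [F] within [r / 2] of [x] could be
   added to [E]: its distance to [F] is below [r / 2], and its distance to each [y] in [E] is at
   least [r / 2]. The factor 2 in [P] absorbs the bound of the distance from [y] to [F] through
   [z]. *)
- move=> x Fx V /nbhs_mdist[r r0 rV].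
  have : nbhs x [set y | mdist x y < r / 2].
    by apply/nbhs_mdist; exists (r / 2) => //; rewrite divr_gt0.
  move=> /(FD _ Fx)[z [[Dz nFz] /= xz]].
  have zr := le_lt_trans (set_dist_le F z x Fx).
  rewrite metric_sym in zr; have {}zr := zr _ xz.
  apply: contrapT => EV0.
  have nEz : ~ E z by move=> Ez; apply: EV0; exists z; split=> //; apply: rV; lra.
  have far y : E y -> r / 2 <= mdist z y.
    move=> Ey; rewrite leNgt; apply/negP => zy; apply: EV0; exists y; split=> //.
    by apply: rV; have := metric_triangle x z y; lra.
  apply: (Emax (E `|` [set z])).
    by split=> [|/(_ z (or_intror erefl))]; first exact: subsetUl.
  split=> [y [/ED//|->//]|y y' [Ey|->] [Ey'|->]] yy'.
  + exact: Esep.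
  + have := set_dist_triangle F y z; have := far _ Ey.
    rewrite (metric_sym y z); lra.
  + have := far _ Ey'; lra.
  + by rewrite eqxx in yy'.
- move=> x Ex; split; first by apply/mem_set; right.
  have [_ nFx] := ED _ Ex; have [V Vx [VF VE]] := near1 _ nFx.
  exists V => //; apply/seteqP; split=> [y [Vy [Fy|Ey]]|_ ->].
  + by exfalso; rewrite -[False]/(set0 y) -VF.
  + by apply: VE => //; exact: nbhs_singleton.
  + by split; [exact: nbhs_singleton|right].
Qed.

(** The chain grows at its large end, each new set lying one derived set lower; hence the induction
    is for all [m]. The last two conclusions are what [derived_set_closure] requires for the next
    extension. *)
Lemma derived_set_chain n m x : derived_set (n + m) x ->
  exists F : nat -> set K, [/\ nowhere_dense_chain F, F n !=set0,
    F n.+1 = set0, F 0%N `<=` derived_set m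
    & F 0%N `<=` closure (isolated (F 0%N))].
Proof.
elim: n m => [|n IH] m dx.
  exists (chain_cons [set x] (fun=> set0)); split=> //=.
  - apply: nowhere_dense_chain_cons => //.
      by split=> _ => [|//|y []]; exact: closed0.
    apply: accessible_closed_set1; apply: hausdorff_accessible.
    exact: metric_hausdorff.
  - by exists x.
  - by move=> _ ->.
  - move=> _ ->; apply: subset_closure; split; first exact/mem_set.
    by exists setT; [exact: filterT|rewrite setTI].
have [|F [cF [y Fny] Fn1 F0d F0i]] := IH m.+1; first by rewrite addnS -addSn.
have [clF _ _] := cF.
have [||E [ED clE FE Ei]] := discrete_extension _ (derived_set m) (clF 0%N).
- by exists y; apply: chain_le cF (leq0n n) _ Fny.
- exact: derived_set_closure.
exists (chain_cons (F 0%N `|` E) F); split=> //=.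
- apply: nowhere_dense_chain_cons => //.
  apply: subset_trans FE _; apply: closureS => z Ez.
  by split; [right|have [_] := ED _ Ez].
- by exists y.
- by move=> z [/F0d[]//|/ED[]].
- apply: subset_trans (closureS Ei) => z [/FE//|Ez].
  exact: subset_closure.
Qed.

Lemma full_chain n : (0 < n)%N -> (derived_set n : set K) !=set0 ->
  exists F : nat -> set K, [/\ nowhere_dense_chain F, F 0%N = setT,
    F n !=set0 & F n.+1 = set0].
Proof.
case: n => [//|n] _ [x dx].
(* One level is kept back: the whole space is the largest set, and [m = 1] ensures that its
   remaining points accumulate at [F 0]. *)
have /derived_set_chain : derived_set (n + 1) x by rewrite addn1.
move=> [F [cF Fn Fn1 F0d F0i]]; exists (chain_cons setT F); split=> //.
apply: nowhere_dense_chain_cons => //.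
exact: (derived_set_closure 0%N).
Qed.

End metric_chains.

(** * The modulus and convergence in the complex numbers *)

Section complex_topology.
Context {R : realType}.
Local Notation normc := Normc.normc.

Lemma normc_sym (a b : R[i]) : normc (a - b) = normc (b - a).
Proof. by rewrite -normcN opprB. Qed.

Lemma le_normc_dist (b a c : R[i]) :
  normc (a - c) <= normc (a - b) + normc (b - c).
Proof. by rewrite -(subrKA b) le_normcD. Qed.

Lemma normc_ge0 (a : R[i]) : 0 <= normc a.
Proof. by case: a => x y; exact: sqrtr_ge0. Qed.

Lemma ler_dist_normc (a b : R[i]) : `|normc a - normc b| <= normc (a - b).
Proof.
have ab := le_normcD (a - b) b; have ba := le_normcD (b - a) a.
rewrite !subrK (normc_sym b) in ab ba.
by rewrite ler_norml; apply/andP; split; lra.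
Qed.

(** The norm of [R[i]^o] takes values in [R[i]], so radii are complex there; a positive one has zero
    imaginary part, which reduces to real radii. *)
Lemma cvg_normcP {I : Type} (F : set_system I) (FF : Filter F)
    (f : I -> R[i]^o) (l : R[i]^o) :
  f @ F --> l <->
  forall e : R, 0 < e -> \forall t \near F, normc (f t - l) < e.
Proof.
split=> [/cvgrPdist_lt fl e e0|fl].
  have /fl : (0 : R[i]) < e%:C%C by rewrite ltcR.
  by apply: filterS => t; rewrite distrC ltcR.
apply/cvgrPdist_lt => e e0.
have [e1 e2] : 0 < complex.Re e /\ e = (complex.Re e)%:C%C.
  by move: e0; case: e => a b; rewrite ltcE/= => /andP[/eqP -> ->].
by apply: filterS (fl _ e1) => t; rewrite e2 distrC ltcR.
Qed.

End complex_topology.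

(** * Lower bound for the D-norm by forced oscillation *)

Section D_norm_lower.
Context {R : realType} {T : topologicalType}.
Local Notation normc := Normc.normc.

(* From a point of [L i] where the partial sums are close to [f], continuity gives
   a point of [L i.+1] where they start close to the old value of [f] and still
   have to reach the new one. *)
Lemma D_norm_ge (f : T -> R[i]) (L : nat -> set T) (n : nat) (c : R) :
  L 0%N !=set0 -> (forall x, L 0%N x -> c <= normc (f x)) ->
  (forall i, (i < n)%N -> L i `<=` closure (L i.+1)) ->
  (forall i x y, (i < n)%N -> L i x -> L i.+1 y -> 1 <= normc (f y - f x)) ->
  ((c + n%:R)%:E <= D_norm f)%E.
Proof.
move=> [x0 Lx0] L0c Lcl Lf; apply: le_ereal_inf_tmp => _ [phi [cphi _ sphi] <-].
pose psum N x := \sum_(0 <= j < N) phi j x.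
pose nsum N x := \sum_(0 <= j < N) normc (phi j x).
have limp x e : 0 < e -> exists N0, forall N, (N0 <= N)%N ->
    normc (psum N x - f x) < e.
  move=> e0; have /cvg_normcP/(_ e e0)[N0 _ NP] := sphi x.
  by exists N0 => N /NP.
have contp N x e : 0 < e -> nbhs x [set y | normc (psum N y - psum N x) < e].
  have : continuous (psum N : T -> R[i]^o).
    by move=> y; apply: cvg_big => [|j _]; [exact: add_continuous|exact: cphi].
  by move=> /(_ x)/cvg_normcP; exact.
have contn N x e : 0 < e -> nbhs x [set y | `|nsum N x - nsum N y| < e].
  have : continuous (nsum N : T -> R).
    move=> y; apply: cvg_big => [|j _]; first exact: add_continuous.
    apply/cvgrPdist_lt => r r0.
    have /cvg_normcP/(_ r r0) := cphi j y.
    by apply: filterS => z; apply: le_lt_trans; rewrite distrC ler_dist_normc.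
  by move=> /(_ x)/cvgrPdist_lt; exact.
have nsumD N M x : (N <= M)%N ->
    nsum N x + normc (psum M x - psum N x) <= nsum M x.
  move=> NM; rewrite /nsum (big_cat_nat (n := N) (p := M))//= lerD2l.
  rewrite /psum (big_cat_nat (n := N) (p := M))//= addrAC subrr add0r.
  elim/big_ind2 : _ => [|u a v b ua vb|//]; first by rewrite Normc.normc0.
  by apply: le_trans (le_normcD _ _) _; exact: lerD.
have key i e : (i <= n)%N -> 0 < e -> exists x N, [/\ L i x,
    c + i%:R - e < nsum N x & normc (psum N x - f x) < e].
  elim: i e => [|i IH] e.
    move=> _ e0; have [N /(_ N (leqnn N)) NP] := limp x0 e e0.
    exists x0, N; split=> //; rewrite addr0 ltrBlDr.
    have n0 : nsum 0%N x0 = 0 by rewrite /nsum big_geq.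
    have p0 : psum 0%N x0 = 0 by rewrite /psum big_geq.
    have := nsumD 0%N N x0 isT; rewrite n0 p0 subr0 add0r => sN.
    have := le_normcD (f x0 - psum N x0) (psum N x0); rewrite subrK normc_sym.
    have := L0c _ Lx0; lra.
  (* Five errors below [e / 8] occur: one from the induction hypothesis, one in passing [nsum N]
     from [x] to [y], and three in the triangle inequality isolating the increment of [psum] at [y]
     between [N] and [M]. *)
  move=> ni e0; have e8 : 0 < e / 8 by rewrite divr_gt0.
  have [x [N [Lx xc xf]]] := IH _ (ltnW ni) e8.
  have [y [Ly [/= yn yp]]] := Lcl _ ni _ Lx _
    (filterI (contn N x _ e8) (contp N x _ e8)).
  have [M0 MP] := limp y _ e8.
  exists y, (maxn N M0); have {}MP := MP _ (leq_maxr N M0).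
  split=> //; last by apply: lt_trans MP _; lra.
  have := nsumD _ _ y (leq_maxl N M0); move: MP.
  have := Lf _ _ _ ni Lx Ly.
  set M := maxn _ _ => fxy MP sM.
  have : normc (f y - f x) <= normc (psum M y - f y) + normc (psum M y - psum N y)
     + normc (psum N y - psum N x) + normc (psum N x - f x).
    have := le_normc_dist (psum M y) (f y) (f x).
    have := le_normc_dist (psum N y) (psum M y) (f x).
    have := le_normc_dist (psum N x) (psum N y) (f x).
    rewrite (normc_sym (f y) (psum M y)); lra.
  move: yn; rewrite ltr_norml -[i.+1%:R]natr1 => /andP[? ?]; lra.
apply/lee_subgt0Pr => e e0.
have [x [N [_ xN _]]] := key _ _ (leqnn n) e0.
apply: (@le_trans _ _ (nsum N x)%:E); first by rewrite -EFinD lee_fin ltW.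
apply: (@le_trans _ _ (\sum_(0 <= j <oo) (normc (phi j x))%:E)%E); last first.
  by apply: ereal_sup_ubound; exists x.
rewrite /nsum -sumEFin; apply: nneseries_lim_ge => j _ _.
by rewrite lee_fin; exact: normc_ge0.
Qed.

End D_norm_lower.

(** * Upper bound for the D-norm of combinations of open indicators *)

Section D_norm_upper.
Context {R : realType}.
Local Notation normc := Normc.normc.

Lemma normc_real (a : R) : normc a%:C%C = `|a|.
Proof. by rewrite /= expr0n/= addr0 sqrtr_sqr. Qed.

(** The increments of [g] are nonnegative continuous functions whose series sums to the indicator of
    [U]; truncated multiples of the distance to the complement serve as [g]. *)
Lemma open_indic_approx {K : metricType R} (U : set K) : open U ->
  exists g : nat -> K -> R, [/\ forall j, continuous (g j),
    forall x, g 0%N x = 0, forall j x, g j x <= g j.+1 x,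
    forall j x, g j x <= 1
    & forall x, \forall j \near \oo, g j x = \1_U x].
Proof.
(* When [U] is everything, the distance to its empty complement would be 0, so constants are used
   instead. *)
move=> oU; have [UT|/set0P nU] := eqVneq (~` U) set0.
  have {}UT : U = setT by rewrite -[U]setCK UT setC0.
  exists (fun j _ => (0 < j)%:R); split=> //.
  - by move=> j x; exact: cvg_cst.
  - by case.
  - by case.
  - by move=> x; exists 1%N => // -[//|j] _; rewrite UT indicT.
pose d := set_dist (~` U).
exists (fun j x => Num.min 1 (j%:R * d x)); split.
- move=> j x; apply: (@continuous_min R K (fun=> 1) (fun x => j%:R * d x)).
    exact: cvg_cst.
  by apply: cvgM; [exact: cvg_cst|exact: set_dist_continuous].
- by move=> x; rewrite mul0r; apply/min_idPr.
- move=> j x; rewrite le_min ge_min lexx/= ge_min.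
  by rewrite ler_wpM2r ?orbT ?set_dist_ge0// ler_nat.
- by move=> j x; rewrite ge_min lexx.
- move=> x; have [Ux|nUx] := pselect (U x); last first.
    apply: nearW => j; rewrite indicE memNset// /d set_dist_eq0// mulr0.
    by apply/min_idPr.
  have dx : 0 < d x.
    by apply: set_dist_gt0 => //; exact: open_closedC.
  exists (Num.truncn (d x)^-1).+1 => // j /= jd; rewrite indicE mem_set//.
  apply/min_idPl; rewrite -ler_pdivrMr// div1r.
  by apply: le_trans (ltW (truncnS_gt _)) _; rewrite ler_nat.
Qed.

(** Combining the increments of the approximations with weights [s i] gives a representation; its
    absolute series telescopes, each [i] contributing at most [|s i|]. *)
Lemma D_norm_sum_indic_le {K : metricType R} (N : nat) (s : 'I_N -> R)
    (U : 'I_N -> set K) : (forall i, open (U i)) ->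
  (D_norm (fun x => (\sum_i s i * \1_(U i) x)%:C%C) <= (\sum_i `|s i|)%:E)%E.
Proof.
move=> oU; have /choice[g gP] i := open_indic_approx _ (oU i).
pose phi j x : R[i] := (\sum_i s i * (g i j.+1 x - g i j x))%:C%C.
have bound x : (\sum_(0 <= j <oo) (normc (phi j x))%:E <= (\sum_i `|s i|)%:E)%E.
  apply: lime_le.
    by apply: is_cvg_nneseries => j _ _; rewrite lee_fin normc_ge0.
  apply: nearW => M; rewrite sumEFin lee_fin.
  apply: (@le_trans _ _ (\sum_(0 <= j < M) \sum_i `|s i| * (g i j.+1 x - g i j x))).
    apply: ler_sum => j _; rewrite normc_real.
    apply: le_trans (ler_norm_sum _ _ _) _; apply: ler_sum => i _.
    have [_ _ gi _ _] := gP i.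
    by rewrite normrM [X in _ * X]ger0_norm// subr_ge0.
  rewrite exchange_big/=; apply: ler_sum => i _; rewrite -mulr_sumr.
  have [_ g0 _ g1 _] := gP i.
  by rewrite telescope_sumr// g0 subr0 ler_piMr.
have supbound : (sup_abs_series phi <= (\sum_i `|s i|)%:E)%E.
  by apply: ub_ereal_sup => _ [x _ <-]; exact: bound.
apply: (le_trans _ supbound); apply: ereal_inf_lbound; exists phi => //; split.
- move=> j x; apply/cvg_normcP => e e0.
  have : continuous (fun x => \sum_i s i * (g i j.+1 x - g i j x)).
    move=> y; apply: cvg_big => [|i _]; first exact: add_continuous.
    have [cg _ _ _ _] := gP i.
    by apply: cvgM; [exact: cvg_cst|apply: cvgB; exact: cg].
  move=> /(_ x)/cvgrPdist_lt/(_ _ e0); apply: filterS => y.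
  by rewrite /phi -rmorphB normc_real distrC.
- exact: le_lt_trans supbound (ltry _).
- move=> x; apply/cvg_normcP => e e0.
  have : \forall M \near \oo, forall i, g i M x = \1_(U i) x.
    by apply: filter_forall => i; have [_ _ _ _ +] := gP i; exact.
  apply: filterS => M gM; rewrite /series/= /phi -rmorph_sum/= exchange_big/=.
  under eq_bigr => i _.
    rewrite -mulr_sumr telescope_sumr//.
    have [_ -> _ _ _] := gP i; rewrite subr0 gM; over.
  by rewrite !subrr expr0n addr0 sqrtr0.
Qed.

(** * Membership in D(K) of combinations of open indicators *)

Lemma bounded_lscD {T : topologicalType} (f g : T -> R) :
  bounded_lsc f -> bounded_lsc g -> bounded_lsc (f \+ g).
Proof.
move=> [bf lf] [bg lg]; split; first exact: (@bounded_funD T R).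
move=> x a; rewrite /= lte_fin => afg.
pose e := (f x + g x - a) / 2; have e0 : 0 < e by rewrite divr_gt0// subr_gt0.
have [|V Vx Vf] := lf x (f x - e); first by rewrite lte_fin ltrBlDr ltrDl.
have [|W Wx Wg] := lg x (g x - e); first by rewrite lte_fin ltrBlDr ltrDl.
exists (V `&` W); first exact: filterI.
move=> y [/Vf + /Wg]; rewrite !lte_fin /e; lra.
Qed.

Lemma bounded_lsc_scaled_indic {T : topologicalType} (c : R) (U : set T) :
  0 <= c -> open U -> bounded_lsc (fun x => c * \1_U x).
Proof.
move=> c0 oU; split.
  exists c; split; first exact: num_real.
  move=> M cM x _; apply: le_trans (ltW cM); rewrite normrM ger0_norm//.
  by rewrite indicE; case: (x \in U); rewrite ?normr1 ?normr0 ?mulr1 ?mulr0.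
move=> x a; rewrite /= lte_fin => ax; have [Ux|nUx] := pselect (U x).
  exists U; first exact: open_nbhs_nbhs.
  by move=> y Uy; rewrite lte_fin; move: ax; rewrite !indicE !mem_set.
exists setT; first exact: filterT.
move=> y _; rewrite lte_fin; apply: lt_le_trans ax _.
by rewrite (_ : \1_U x = 0) ?mulr0 ?mulr_ge0// indicE memNset.
Qed.

Lemma bounded_lsc_sum_indic {T : topologicalType} (N : nat) (s : 'I_N -> R)
    (U : 'I_N -> set T) : (forall i, 0 <= s i) -> (forall i, open (U i)) ->
  bounded_lsc (fun x => \sum_i s i * \1_(U i) x).
Proof.
move=> s0 oU.
rewrite (_ : (fun x => _) = \sum_i (fun x => s i * \1_(U i) x)); last first.
  by apply/funext => x; rewrite fct_sumE.
elim/big_ind : _ => [|f g|i _].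
- rewrite (_ : 0 = (fun x => 0 * \1_[set: T] x)).
    by apply: bounded_lsc_scaled_indic => //; exact: openT.
  by apply/funext => x; rewrite mul0r.
- exact: bounded_lscD.
- exact: bounded_lsc_scaled_indic.
Qed.

(** Each coefficient is split into positive and negative parts, since nonnegative multiples of open
    indicators are lower semicontinuous. *)
Lemma D_space_sum_indic {T : topologicalType} (N : nat) (s : 'I_N -> R)
    (U : 'I_N -> set T) : (forall i, open (U i)) ->
  D_space (fun x => (\sum_i s i * \1_(U i) x)%:C%C).
Proof.
move=> oU; pose S (t : 'I_N -> R) x := \sum_i t i * \1_(U i) x.
have lS t : (forall i, 0 <= t i) -> bounded_lsc (S t).
  by move=> t0; exact: bounded_lsc_sum_indic.
exists (S (fun i => Num.max (s i) 0)), (S (fun i => Num.max (- s i) 0)).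
exists (S (fun=> 0)), (S (fun=> 0)); split.
- by apply: lS => i; rewrite le_max lexx orbT.
- by apply: lS => i; rewrite le_max lexx orbT.
- exact: lS.
- exact: lS.
apply/funext => x; congr Complex; last by rewrite subrr.
rewrite /S -sumrB; apply: eq_bigr => i _; rewrite -mulrBl; congr (_ * _).
by case: (lerP (s i) 0) => ?; case: (lerP (- s i) 0) => ?; lra.
Qed.

End D_norm_upper.

(** * The exact D-norm of a parity union *)

Section parity_union_norm.
Context {R : realType}.
Local Notation normc := Normc.normc.

Lemma indic_parity_union_stratum {T : topologicalType} (F : nat -> set T) b m x :
  nowhere_dense_chain F -> stratum F m x ->
  \1_(parity_union F b) x = (odd m == b)%:R :> R[i].
Proof.
move=> cF Fx; have aF := parity_union_stratum _ b _ _ cF Fx.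
rewrite indicE; congr (_%:R); congr nat_of_bool.
by apply/idP/eqP => [/set_mem/aF|/aF/mem_set].
Qed.

(* Summation by parts over the increasing open sets [~` F m.+1], [m <= n]. *)
Lemma indic_parity_union_sum {T : topologicalType} (F : nat -> set T) b n :
  nowhere_dense_chain F -> F 0%N = setT -> F n.+1 = set0 ->
  let v m : R := ((odd m == b) && (m <= n)%N)%:R in
  (\1_(parity_union F b) : T -> R[i]) =
  (fun x => (\sum_(m < n.+1) (v m - v m.+1) * \1_(~` F m.+1) x)%:C%C).
Proof.
move=> cF F0 Fn1 v; apply/funext => x.
have [||r rn Fx] := chain_stratum _ n x cF; [by rewrite F0|by rewrite Fn1|].
rewrite (indic_parity_union_stratum _ _ _ _ cF Fx).
(* For [x] in [stratum F r], the [m]-th indicator is 1 exactly when [r <= m], so the sum telescopes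
   to [v r - v n.+1]; the cutoff [m <= n] in [v] makes [v n.+1] vanish. *)
rewrite -(big_mkord xpredT (fun m => (v m - v m.+1) * \1_(~` F m.+1) x)).
rewrite (big_cat_nat (n := r))//=; last exact: leqW.
rewrite big_nat_cond big1 ?add0r => [|m /andP[/andP[_ mr] _]]; last first.
  rewrite indicE memNset ?mulr0//= => nFx; apply: nFx.
  by case: Fx => Fx _; apply: chain_le mr _ Fx.
rewrite (eq_big_nat _ _ (F2 := fun m => - (v m.+1 - v m))) => [|m /andP[rm _]].
  rewrite sumrN telescope_sumr ?leqW// opprB /v ltnn andbF subr0 rn andbT.
  by rewrite rmorph_nat.
rewrite indicE mem_set ?mulr1 ?opprB// => Fm1; case: Fx => _; apply.
exact: chain_le Fm1.
Qed.

Lemma D_norm_indic_parity_union {K : metricType R} (F : nat -> set K) b n :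
  nowhere_dense_chain F -> F 0%N = setT -> F n !=set0 -> F n.+1 = set0 ->
  D_space (\1_(parity_union F b) : K -> R[i]) /\
  D_norm (\1_(parity_union F b) : K -> R[i]) = ((odd n == b)%:R + n%:R)%:E.
Proof.
move=> cF F0 Fn Fn1; have indE := indic_parity_union_sum _ b _ cF F0 Fn1.
have oF (m : 'I_n.+1) : open (~` F m.+1) by case: cF => clF _ _; exact: closed_openC.
split; first by rewrite indE; exact: D_space_sum_indic.
apply/eqP; rewrite eq_le; apply/andP; split.
  (* The coefficients with [m < n] have modulus 1, and the last one is [v n], so the moduli add up
     to the claimed value. *)
  rewrite indE; apply: le_trans (D_norm_sum_indic_le _ _ _ oF) _.
  rewrite lee_fin big_ord_recr/= ltnn andbF subr0 leqnn andbT normr_nat addrC.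
  rewrite lerD2l (eq_bigr (fun=> 1)) ?sumr_const ?card_ord// => m _.
  rewrite ltn_ord (ltnW (ltn_ord m)) !andbT.
  by case: (odd m); case: (b); rewrite /= ?subr0 ?sub0r ?normrN normr1.
(* The descent starts on [F n], which is its own stratum as [F n.+1] is empty; there the indicator
   equals the constant [c]. Adjacent strata have opposite parities, so each of the [n] moves is a
   jump of 1. *)
apply: (D_norm_ge _ (fun i => stratum F (n - i))).
- by rewrite subn0; case: Fn => x Fx; exists x; split=> //; rewrite Fn1.
- move=> x; rewrite subn0 => Fx; rewrite (indic_parity_union_stratum _ _ _ _ cF Fx).
  by rewrite -(rmorph_nat (real_complex R)) normc_real normr_nat.
- move=> i ni; rewrite subnS -[X in stratum F X `<=` _]prednK ?subn_gt0//.
  exact: stratum_closure.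
move=> i x y ni; rewrite subnS; set k := (n - i)%N => Fx Fy.
rewrite (indic_parity_union_stratum _ _ _ _ cF Fx).
rewrite (indic_parity_union_stratum _ _ _ _ cF Fy).
rewrite -!(rmorph_nat (real_complex R)) -rmorphB normc_real.
have -> : odd k = ~~ odd k.-1.
  by rewrite -[in LHS](@prednK k) ?subn_gt0.
by case: (odd k.-1); case: (b); rewrite /= ?subr0 ?sub0r ?normrN normr1.
Qed.

End parity_union_norm.

Theorem proposition2p6 (R : realType) (K : metricType R)
    (hK : forall n : nat, (0 < n)%N -> (derived_set n : set K) !=set0) :
  forall n : nat, (0 < n)%N ->
  exists A B : set K,
    [/\ boundary_index A = n%:E%E, boundary_index B = n%:E%E,
        D_space (\1_A : K -> R[i]) /\ D_norm (\1_A : K -> R[i]) = n%:R%:E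
      & D_space (\1_B : K -> R[i]) /\ D_norm (\1_B : K -> R[i]) = n.+1%:R%:E].
Proof.
move=> n n0; have [F [cF F0 Fn Fn1]] := full_chain n n0 (hK n n0).
have norm b := D_norm_indic_parity_union F b n cF F0 Fn Fn1.
(* The first set omits [F n] and the second contains it, which accounts for the difference of 1
   between the norms. *)
exists (parity_union F (~~ odd n)), (parity_union F (odd n)); split.
- exact: boundary_index_parity_union.
- exact: boundary_index_parity_union.
- by have := norm (~~ odd n); case: (odd n); rewrite add0r.
- by have := norm (odd n); rewrite eqxx nat1r.
Qed.
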